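(* Let $p,q,d$ be positive integers with $d\geq 2$, and let $T_d$ denote the infinite $d$-regular tree. Maker has a winning strategy for the $(p,q)$-percolation game on $T_d$ if and only if $p(d-2)\geq q$.
   Context: The $(p,q)$-percolation game on $(\Lambda,v_0)$, where $\Lambda$ is an infinite connected (multi)graph, $v_0$ is a vertex of $\Lambda$ and $p,q$ are positive integers: two players, Maker and Breaker, play in alternating turns, with Maker playing first. Initially all edges of $\Lambda$ are marked as unsafe. On each of her turns, Maker marks $p$ unsafe edges as safe; on each of his turns, Breaker takes $q$ unsafe edges and deletes them from the graph. Breaker wins if at any time in the game the component containing $v_0$ (in the graph of edges not deleted) becomes finite. If Maker is able to ensure that $v_0$ remains in an infinite component indefinitely, then she is said to have a winning strategy. If $\Lambda$ is vertex-transitive, the choice of $v_0$ does not matter and one speaks of the $(p,q)$-percolation game on $\Lambda$. The infinite $d$-regular tree is the infinite tree in which every vertex has degree exactly $d$. *)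

(* Defs.v *)
From HB Require Import structures.
From mathcomp Require Import all_boot finmap.
From mathcomp Require Import boolp classical_sets functions cardinality.

Set Implicit Arguments.
Unset Strict Implicit.
Unset Printing Implicit Defensive.

Local Open Scope classical_set_scope.
Local Open Scope fset_scope.

(* The order in the pair [ends e] is an arbitrary orientation of the undirected
   edge [e]; loops and parallel edges are allowed. *)
Record multigraph := Multigraph {
  vertex : choiceType;
  edge : choiceType;
  ends : edge -> vertex * vertex }.

Section Multigraph.
Variable G : multigraph.
Implicit Types (u v w : vertex G) (D : {fset edge G}).

(* An edge together with a direction of traversal. *)
Definition dart : Type := (edge G * bool)%type.

Definition source (x : dart) : vertex G :=
  if x.2 then (ends x.1).1 else (ends x.1).2.

Definition target (x : dart) : vertex G :=
  if x.2 then (ends x.1).2 else (ends x.1).1.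

Fixpoint walk u (s : seq dart) v : bool :=
  if s is x :: s' then (source x == u) && walk (target x) s' v else u == v.

Definition component D v : set (vertex G) :=
  [set w | exists2 s, walk v s w & all (fun x : dart => x.1 \notin D) s].

Definition connected_graph : Prop := forall u v, exists s, walk u s v.

(* Since edges must be distinct, loops and pairs of parallel edges are cycles,
   but going back and forth along one edge is not. *)
Definition is_cycle (s : seq dart) : Prop :=
  [/\ s != [::], exists v, walk v s v,
      uniq [seq x.1 | x <- s] & uniq [seq target x | x <- s]].

Definition acyclic : Prop := forall s, ~ is_cycle s.

(* Counting darts rather than edges makes a loop contribute 2. *)
Definition has_degree v (d : nat) : Prop := ([set x | source x = v] #= `I_d)%card.

Definition infinite_regular_tree (d : nat) : Prop :=
  [/\ infinite_set [set: vertex G], connected_graph, acyclic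
    & forall v, has_degree v d].

End Multigraph.

Section PercolationGame.
Variable G : multigraph.

(* The list of completed rounds, oldest first; each round consists of the set
   of edges marked safe by Maker and the set of edges deleted by Breaker. *)
Definition history : Type := seq ({fset edge G} * {fset edge G}).

Implicit Types (h : history) (M B S : {fset edge G}).

Definition safe h : {fset edge G} := \bigcup_(r <- h) r.1.

Definition deleted h : {fset edge G} := \bigcup_(r <- h) r.2.

Definition maker_legal (p : nat) h M : Prop :=
  #|` M| = p /\ forall e, e \in M -> e \notin safe h /\ e \notin deleted h.

(* [M] is the move Maker has just made in the current round. *)
Definition breaker_legal (q : nat) h M B : Prop :=
  #|` B| = q /\
  forall e, e \in B -> [/\ e \notin safe h, e \notin M & e \notin deleted h].

Definition strategy : Type := history -> {fset edge G}.

(* The histories that can arise when Maker follows [sigma] and Breaker plays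
   any legal moves. *)
Inductive play (q : nat) (sigma : strategy) : history -> Prop :=
| play_start : play q sigma [::]
| play_round h B :
    play q sigma h -> breaker_legal q h (sigma h) B ->
    play q sigma (rcons h (sigma h, B)).

(* Only Breaker's moves change the component of [v0], so it is enough to look
   at it at the end of each round. *)
Definition winning (p q : nat) (v0 : vertex G) (sigma : strategy) : Prop :=
  forall h, play q sigma h ->
    maker_legal p h (sigma h) /\ infinite_set (component (deleted h) v0).

Definition maker_has_winning_strategy (p q : nat) (v0 : vertex G) : Prop :=
  exists sigma, winning p q v0 sigma.

End PercolationGame.

(* Main.v *)
(* Maker keeps a supply of at least d branches of the tree that hang off the safe
   component of v0 and that neither player has touched. Marking the first edge
   of such a branch replaces it by d - 1 branches, so a turn of Maker gains
   p(d - 2) of them; since the branches are disjoint, a deleted edge spoils at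
   most one, so Breaker's turn destroys at most q.

   Breaker only deletes edges incident to the safe component of v0. This
   component is spanned by a tree whose k edges are all safe, so at most
   d(k + 1) - 2k = d + (d - 2)k other edges are incident to it; after t rounds
   k <= pt while qt edges have been deleted, so if q > p(d - 2) Breaker runs out
   of such edges after at most d rounds, and has then isolated the component. *)

Require Import Defs.
From HB Require Import structures.
From mathcomp Require Import all_boot finmap.
From mathcomp Require Import boolp classical_sets functions cardinality.
From mathcomp Require Import zify.

Set Implicit Arguments.
Unset Strict Implicit.
Unset Printing Implicit Defensive.

Local Open Scope fset_scope.

Lemma map_nuniq_split (S T : eqType) (f : S -> T) (s : seq S) :
  ~~ uniq (map f s) ->
  exists x y s1 s2 s3, s = s1 ++ x :: s2 ++ y :: s3 /\ f x = f y.
Proof.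
elim: s => //= x s IH; rewrite negb_and negbK => /orP[/mapP[y ys xy]|].
  by case/path.splitPr: ys => s2 s3; exists x, y, [::], s2, s3.
by case/IH=> a [b [s1 [s2 [s3 [-> ab]]]]]; exists a, b, (x :: s1), s2, s3.
Qed.

(** * Reduced walks in an acyclic multigraph and their uniqueness *)

Section ReducedWalks.
Variable G : multigraph.
Implicit Types (u v w : vertex G) (x y z : dart G) (s t : seq (dart G)).

Definition flip x : dart G := (x.1, ~~ x.2).

Lemma flipK : involutive flip.
Proof. by case=> e b; rewrite /flip /= negbK. Qed.

Lemma source_flip x : source (flip x) = target x.
Proof. by case: x => e []. Qed.

Lemma target_flip x : target (flip x) = source x.
Proof. by case: x => e []. Qed.

Lemma same_edge x y : x.1 = y.1 -> y = x \/ y = flip x.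
Proof.
by case: x y => e b [e' b'] /= ->; case: b b' => [] []; [left|right|right|left].
Qed.

Definition endpoint u s : vertex G := last u [seq target x | x <- s].

Lemma walk_endpoint u s v : walk u s v -> endpoint u s = v.
Proof.
by elim: s u => [|x s IH] u /=; [move/eqP | case/andP=> _ /IH].
Qed.

Lemma walk_cat u s t v :
  walk u (s ++ t) v = walk u s (endpoint u s) && walk (endpoint u s) t v.
Proof.
by elim: s u => [|x s IH] u /=; rewrite ?eqxx // IH andbA.
Qed.

Lemma walk_cat_intro u s v t w : walk u s v -> walk v t w -> walk u (s ++ t) w.
Proof.
by move=> us vt; rewrite walk_cat (walk_endpoint us) us vt.
Qed.

Lemma walk_rcons u s x v :
  walk u (rcons s x) v = [&& walk u s (source x) & target x == v].
Proof.
rewrite -cats1 walk_cat /=; apply/and3P/andP => [[us /eqP -> ->]|[us ->]] //.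
by rewrite (walk_endpoint us) us eqxx.
Qed.

Lemma walk_rev u s v : walk u s v -> walk v (rev (map flip s)) u.
Proof.
elim: s u => [|x s IH] u /=; first by rewrite eq_sym.
case/andP=> /eqP xu /IH sx.
by rewrite rev_cons walk_rcons source_flip sx target_flip xu eqxx.
Qed.

Definition reduced s : bool := sorted (fun x y => y != flip x) s.

Lemma reduced_rev s : reduced s -> reduced (rev (map flip s)).
Proof.
rewrite /reduced rev_sorted sorted_map; apply: sub_sorted => x y /=.
by apply: contraNN => /eqP /(can_inj flipK) ->; rewrite flipK.
Qed.

Lemma reduced_cat2 s t : reduced (s ++ t) -> reduced s /\ reduced t.
Proof. by case/cat_sorted2. Qed.

Lemma reduced_rcons2 s x y :
  reduced (rcons (rcons s x) y) = reduced (rcons s x) && (y != flip x).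
Proof.
by case: s => [|z s]; rewrite /reduced /= ?andbT // !rcons_path last_rcons.
Qed.

(* Two occurrences of an edge would be in opposite directions, hence
   consecutive. *)
Lemma reduced_uniq_edges u v s : walk u s v -> reduced s ->
  uniq [seq target x | x <- s] -> uniq [seq x.1 | x <- s].
Proof.
elim: s u => [|x s IH] u //= /andP[_ ws] red /andP[xs us].
have rs : reduced s by apply: path_sorted red.
rewrite (IH _ ws rs us) andbT; apply/negP => /mapP[y ys xy].
case: (same_edge xy) => yE; first by rewrite -yE map_f in xs.
move: ys ws red us xs; rewrite yE => ys; case/path.splitPr: ys => s1 s2.
(* If nothing separates [x] from [flip x], the walk backtracks; otherwise the dart [z] just before
   [flip x] ends at [target x], which is then a repeated target. *)
rewrite walk_cat /= source_flip; case: (lastP s1) => [|s1' z].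
  by rewrite /= eqxx.
rewrite walk_rcons => /andP[/andP[_ /eqP zE] /andP[/eqP xE _]] _ _.
by rewrite xE -zE map_cat map_rcons mem_cat mem_rcons inE eqxx.
Qed.

(** Induction on the length: a nonempty closed reduced walk with distinct targets is a cycle, and
    otherwise the segment between two visits to the same target is a shorter nonempty closed reduced
    walk. *)
Lemma closed_reduced_nil u s :
  acyclic G -> walk u s u -> reduced s -> s = [::].
Proof.
move=> acyc; have [n] := ubnP (size s); elim: n s u => // n IH s u sn ws rs.
have [-> //|s0] := eqVneq s [::].
have [us|] := boolP (uniq [seq target x | x <- s]).
  case: (acyc s); split=> //; [by exists u | exact: reduced_uniq_edges ws rs us].
case/map_nuniq_split=> x [y [s1 [s2 [s3 [sE xy]]]]].
move: ws rs sn; rewrite {}sE -cat_rcons -(cat_rcons y).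
rewrite walk_cat => /andP[_]; rewrite walk_cat => /andP[+ _].
rewrite /endpoint !map_rcons !last_rcons -xy => w2.
move=> /reduced_cat2[_ /reduced_cat2[r2 _]] sz.
have /IH/(_ w2 r2)/(congr1 size) : size (rcons s2 y) < n.
  by move: sz; rewrite !size_cat !size_rcons; lia.
by rewrite size_rcons.
Qed.

(** Common first darts are stripped. Once the first darts differ, the reverse of one walk followed
    by the other is reduced at the junction too, so it is a nonempty closed reduced walk. *)
Lemma reduced_unique u v s t : acyclic G ->
  walk u s v -> reduced s -> walk u t v -> reduced t -> s = t.
Proof.
move=> acyc; elim: s u t => [|x s IH] u [|y t] //.
- by move=> /= /eqP <- _ wt rt; rewrite (@closed_reduced_nil u (y :: t) acyc wt rt).
- move=> ws rs /= /eqP vu _; rewrite -vu in ws.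
  by have := @closed_reduced_nil u (x :: s) acyc ws rs.
move=> ws rs wt rt; have [xy|xy] := eqVneq y x.
  subst y; case/andP: ws => _ ws; case/andP: wt => _ wt.
  by congr cons; apply: IH ws _ wt _; apply: path_sorted; [exact: rs|exact: rt].
have wc := walk_cat_intro (walk_rev ws) wt.
have /(congr1 size) : rev (map flip (x :: s)) ++ y :: t = [::].
  apply: closed_reduced_nil wc _ => //.
  rewrite /= rev_cons cat_rcons /reduced sorted_cat_cons -rev_cons.
  by rewrite -/(reduced (rev (map flip (x :: s)))) (reduced_rev rs) /= flipK xy.
by rewrite size_cat /= addnS.
Qed.

(** Thus an edge lies in at most one of several disjoint branches. If [y] were [flip x], then [t]
    would end where [rcons s x] does, hence equal it, and [rcons t y] would backtrack. *)
Lemma reduced_last_edge u s t x y : acyclic G -> x.1 = y.1 ->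
  walk u (rcons s x) (target x) -> reduced (rcons s x) ->
  walk u (rcons t y) (target y) -> reduced (rcons t y) ->
  rcons s x = rcons t y.
Proof.
move=> acyc xy ws rs wt rt; have [yE|yE] := same_edge xy.
  by subst y; apply: reduced_unique ws rs wt rt.
have wt' : walk u t (target x).
  by move: wt; rewrite walk_rcons yE source_flip => /andP[].
have rt' : reduced t by move: rt; rewrite -cats1 => /reduced_cat2[].
have tE := reduced_unique acyc wt' rt' ws rs.
by move: rt; rewrite tE reduced_rcons2 yE eqxx andbF.
Qed.

End ReducedWalks.

(** * Counting darts in a regular graph *)

Section RegularGraph.
Variables (G : multigraph) (d : nat).
Hypothesis regular : forall v : vertex G, has_degree v d.
Implicit Types (u v : vertex G) (x y : dart G).

(** [fset_set] defaults to the empty set on infinite sets; regularity rules this out. *)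
Definition star v : {fset dart G} := fset_set [set x | source x = v]%classic.

Lemma in_star v x : (x \in star v) = (source x == v).
Proof.
rewrite /star in_fset_set; last by apply/finite_setP; exists d; exact: regular.
by apply/idP/eqP; rewrite inE.
Qed.

Lemma card_star v : #|` star v| = d.
Proof. exact: card_fset_set (regular v). Qed.

Lemma card_bigfcup_star (C : {fset vertex G}) :
  #|` \bigcup_(v <- C) star v| <= d * #|` C|.
Proof.
elim: (enum_fset C) => [|v s IH]; first by rewrite big_nil cardfs0.
rewrite big_cons /= mulnS; apply: leq_trans (leq_card_fsetU _ _) _.
by rewrite card_star leq_add2l.
Qed.

Lemma in_bigfcup_star (C : {fset vertex G}) x :
  (x \in \bigcup_(v <- C) star v) = (source x \in C).
Proof.
apply/bigfcupP/idP => [[v /andP[vC _]]|xC]; first by rewrite in_star => /eqP ->.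
by exists (source x); rewrite ?xC // in_star.
Qed.

End RegularGraph.

(** * Finite sets of prescribed size *)

Lemma exists_fsubset_card (K : choiceType) (X : {fset K}) n :
  n <= #|` X| -> exists2 B : {fset K}, B `<=` X & #|` B| = n.
Proof.
move=> nX; exists [fset x in take n (enum_fset X)].
  by apply/fsubsetP => x; rewrite !inE => /mem_take.
by rewrite card_fseq undup_id ?take_uniq // size_takel.
Qed.

(** Supplies Breaker's move: [X] holds the edges he wants and [Z] the forbidden ones. If [X] is too
    small, it is padded with arbitrary elements outside [Z], since a move must have exactly [n]
    edges. *)
Lemma exists_nested_fset (K : choiceType) (X Z : {fset K}) n :
  infinite_set [set: K]%classic -> [disjoint X & Z] ->
  exists B : {fset K}, [/\ #|` B| = n, [disjoint B & Z] & B `<=` X \/ X `<=` B].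
Proof.
move=> infK XZ; have [nX|/ltnW Xn] := leqP n #|` X|.
  have [B BX Bn] := exists_fsubset_card nX; exists B; split=> //; last by left.
  by apply: fdisjointWl BX XZ.
have [W _ Wn] := infinite_set_fset (#|` X `|` Z| + n) infK.
have [Y YW Yn] : exists2 Y, Y `<=` W `\` (X `|` Z) & #|` Y| = n - #|` X|.
  apply: exists_fsubset_card; rewrite cardfsD.
  by have := fsubset_leq_card (fsubsetIr W (X `|` Z)); lia.
have YXZ : [disjoint Y & X `|` Z].
  by apply/fdisjointP => e /(fsubsetP YW); rewrite in_fsetD => /andP[].
move: YXZ; rewrite fdisjointXU => /andP[YX YZ].
exists (X `|` Y); split; [|by rewrite fdisjointUX XZ|by right; exact: fsubsetUl].
by rewrite cardfsU fsetIC (eqP YX) cardfs0 Yn; lia.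
Qed.

(** * Finite trees grown from [v0] and the edges incident to them *)

Section Cluster.
Variable (G : multigraph) (v0 : vertex G).
Implicit Types (C : {fset vertex G}) (F S D : {fset edge G}) (x : dart G).

(** A finite subtree with vertex set [C] and edge set [F]: each step attaches a new vertex by one
    edge, so no cycle can arise. *)
Inductive cluster : {fset vertex G} -> {fset edge G} -> Prop :=
| cluster_root : cluster [fset v0] fset0
| cluster_grow C F x : cluster C F -> source x \in C -> target x \notin C ->
    cluster (target x |` C) (x.1 |` F).

Lemma cluster_mem_root C F : cluster C F -> v0 \in C.
Proof. by elim=> [|{}C {}F x _ v0C _ _]; rewrite !inE ?v0C ?orbT. Qed.

(** Being stated for darts, it applies to both directions of an edge, so both ends lie in [C]. *)
Lemma cluster_source C F x : cluster C F -> x.1 \in F -> source x \in C.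
Proof.
move=> cl; elim: cl x => [|{}C {}F y _ IH yC _] x; rewrite !inE //.
case/orP=> [/eqP/esym/same_edge[->|->]|/IH ->]; rewrite ?orbT //.
  by rewrite yC orbT.
by rewrite source_flip eqxx.
Qed.

Lemma card_cluster C F : cluster C F -> #|` C| = #|` F|.+1.
Proof.
elim=> [|{}C {}F x cl IH xC xC']; first by rewrite cardfs1 cardfs0.
rewrite !cardfsU1 xC' IH; case: (boolP (x.1 \in F)) => // xF.
by case/negP: xC'; rewrite -source_flip (cluster_source cl).
Qed.

(** The tree grows as long as an edge of [S] leaves it; each step uses up a new edge of the finite
    set [S]. *)
Lemma cluster_saturate S C F : cluster C F -> F `<=` S ->
  exists C' F', [/\ cluster C' F', F' `<=` S, C `<=` C' &
    forall x, source x \in C' -> x.1 \in S -> target x \in C'].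
Proof.
have [n] := ubnP (#|` S| - #|` F|); elim: n C F => // n IH C F sz cl FS.
have [[x [xC xS xC']]|sat] := pselect (exists x,
    [/\ source x \in C, x.1 \in S & target x \notin C]); last first.
  exists C, F; split=> // x xC xS; apply: contrapT => /negP xC'.
  by apply: sat; exists x.
have xFS : x.1 |` F `<=` S by rewrite fsubUset fsub1set xS.
have cl' := cluster_grow cl xC xC'.
have [] := IH _ _ _ cl' xFS.
  have := fsubset_leq_card xFS.
  have := card_cluster cl'; rewrite cardfsU1 xC' (card_cluster cl) /=; lia.
move=> C' [F' [cl'' F'S CC' sat]]; exists C', F'; split=> //.
by apply: fsubset_trans CC'; exact: fsubsetUr.
Qed.

Lemma card_cluster_boundary d C F D : (forall v : vertex G, has_degree v d) ->
  cluster C F -> [disjoint F & D] ->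
  (forall e, e \in D -> exists2 x, x.1 = e & source x \in C) ->
  #|` D| + 2 * #|` F| <= d * (#|` F|).+1.
Proof.
move=> reg cl FD Dinc; rewrite -(card_cluster cl).
apply: leq_trans (card_bigfcup_star reg C).
(* For an edge [e] of [D], this is a direction of [e] that starts in [C]. *)
pose f e : dart G := (e, source ((e, true) : dart G) \in C).
pose g b e : dart G := (e, b).
have cardg b : #|` [fset g b e | e in F]| = #|` F|.
  by rewrite card_imfset //= => e e' [].
have cardf : #|` [fset f e | e in D]| = #|` D|.
  by rewrite card_imfset //= => e e' [].
have gg : [fset g true e | e in F] `&` [fset g false e | e in F] = fset0.
  apply/fsetP => x; rewrite !inE.
  by apply/andP => -[/imfsetP[e _ ->] /imfsetP[]].
have fg : [fset f e | e in D] `&`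
    ([fset g true e | e in F] `|` [fset g false e | e in F]) = fset0.
  apply/fsetP => x; rewrite !inE; apply/andP => -[/imfsetP[e /= eD ->]].
  by case/orP=> /imfsetP[e' /= e'F [ee' _]]; move/fdisjointP: FD => /(_ e' e'F);
    rewrite -ee' eD.
have -> : (#|` D| + 2 * #|` F|)%N = #|` [fset f e | e in D] `|`
    ([fset g true e | e in F] `|` [fset g false e | e in F])|.
  by rewrite cardfsU fg cardfsU gg !cardfs0 !cardg cardf; lia.
apply: fsubset_leq_card; apply/fsubsetP => x; rewrite (in_bigfcup_star reg) !inE.
case/or3P=> /imfsetP[e /= eX ->]; last 2 first.
- exact: cluster_source cl _.
- exact: cluster_source cl _.
have [[e' b] /= ee'] := Dinc e eX; subst e'; rewrite /f.
by case: (boolP (source (e, true) \in C)) => //; case: b => // /negbTE ->.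
Qed.

End Cluster.

(** * Updating the position after a round; the supply of edges *)

Section History.
Variable G : multigraph.
Implicit Types (h : history G) (M B : {fset edge G}).

Lemma safe_rcons h M B : safe (rcons h (M, B)) = safe h `|` M.
Proof. by rewrite /safe -cats1 big_cat big_seq1. Qed.

Lemma deleted_rcons h M B : deleted (rcons h (M, B)) = deleted h `|` B.
Proof. by rewrite /deleted -cats1 big_cat big_seq1. Qed.

End History.

(** By connectedness every vertex other than [v0] is the target of the last dart of a walk, so
    finitely many edges would leave finitely many vertices. *)
Lemma infinite_edges (G : multigraph) (v0 : vertex G) :
  infinite_set [set: vertex G]%classic -> connected_graph G ->
  infinite_set [set: edge G]%classic.
Proof.
move=> infG conn finE; apply: infG.
pose V : {fset vertex G} := v0 |`
  ([fset (ends e).1 | e in fset_set [set: edge G]%classic] `|`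
   [fset (ends e).2 | e in fset_set [set: edge G]%classic]).
apply: sub_finite_set (finite_fset V) => v _; rewrite /= !inE.
have [s] := conn v0 v; case: (lastP s) => [/= /eqP ->|{}s [e b]].
  by rewrite eqxx.
rewrite walk_rcons => /andP[_ /eqP <-].
have eE : e \in fset_set [set: edge G]%classic by rewrite in_fset_set // inE.
by case: b; rewrite /target /=; apply/or3P; [apply: Or33|apply: Or32];
  apply/imfsetP; exists e.
Qed.

(** * Breaker's play against a supposedly winning [sigma] *)

Section Breaker.
Variables (G : multigraph) (d p q : nat) (v0 : vertex G) (sigma : strategy G).
Hypotheses (regular : forall v : vertex G, has_degree v d)
  (infE : infinite_set [set: edge G]%classic) (win : winning p q v0 sigma).

(** Breaker first saturates the cluster with all safe edges, Maker's latest included, then deletes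
    untouched edges incident to it. There are enough of them, since otherwise he could delete them
    all and isolate a finite component. *)
Lemma breaker_round h C F : play q sigma h -> cluster v0 C F ->
  F `<=` safe h -> [disjoint safe h & deleted h] ->
  (forall e, e \in deleted h -> exists2 x : dart G, x.1 = e & source x \in C) ->
  exists B C' F', let h' := rcons h (sigma h, B) in
    [/\ play q sigma h', #|` B| = q, [disjoint deleted h & B],
        [disjoint safe h' & deleted h'] &
     [/\ cluster v0 C' F', F' `<=` safe h' &
      forall e, e \in deleted h' ->
        exists2 x : dart G, x.1 = e & source x \in C']].
Proof.
move=> ph cl FS SD Dinc; have [[cardM legM] _] := win ph.
have [|C' [F' [cl' F'S CC' sat]]] :=
    cluster_saturate (S := safe h `|` sigma h) cl.
  by apply: fsubset_trans FS _; exact: fsubsetUl.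
pose Z := (safe h `|` sigma h) `|` deleted h.
pose X := [fset x.1 | x in \bigcup_(v <- C') star v] `\` Z.
have [|B [cardB]] := exists_nested_fset (X := X) (Z := Z) q infE.
  by rewrite fdisjoint_sym; apply/fdisjointP => e eZ; rewrite in_fsetD eZ.
rewrite !fdisjointXU -andbA => /and3P[BS BM BD] BX.
have legB : breaker_legal q h (sigma h) B.
  split=> // e eB.
  by split; [move/fdisjointP: BS|move/fdisjointP: BM|move/fdisjointP: BD]; exact.
have ph' := play_round ph legB.
exists B, C', F'; rewrite /= safe_rcons deleted_rcons.
split=> //; first by rewrite fdisjoint_sym.
  rewrite fdisjointXU !fdisjointUX SD -!(fdisjoint_sym B) BS BM /= andbT.
  by apply/fdisjointP => e /legM[].
split=> // e; rewrite inE => /orP[/Dinc[x xe xC]|eB].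
  by exists x => //; exact: (fsubsetP CC').
case: BX => [/fsubsetP/(_ e eB)|XB].
  rewrite in_fsetD => /andP[_ /imfsetP[x /= xQ ->]].
  by exists x => //; rewrite (in_bigfcup_star regular) in xQ.
(* If [B] contains all of [X], every edge at [C'] is safe or deleted, and safe edges do not leave
   [C']. Hence an undeleted walk from [v0] stays in [C'], and its component is finite. *)
have [_ []] := win ph'; apply: sub_finite_set (finite_fset C') => v [s].
rewrite deleted_rcons; have := cluster_mem_root cl'.
elim: s {1 2}v0 => [|x s IH] u uC' /=; first by move=> /eqP <-.
case/andP=> /eqP xu ws /andP[xD sD]; apply: IH ws sD; subst u.
apply: sat => //; apply: contraNT xD => xS.
rewrite inE; have [//|/= xD] := boolP (x.1 \in deleted h).
apply: (fsubsetP XB); rewrite in_fsetD /Z !in_fsetU (negbTE xD) orbF.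
rewrite in_fsetU in xS; rewrite xS.
by apply/imfsetP; exists x; rewrite //= (in_bigfcup_star regular).
Qed.

(** After [t] such rounds the [q * t] deleted edges are incident to a cluster with at most [p * t]
    edges, and [card_cluster_boundary] applies. *)
Lemma breaker_bound t : q * t <= d + (d - 2) * (p * t).
Proof.
have [h [C [F [ph cl FS SD Dinc]]] [cardS cardD]] :
    exists2 h, exists C F, [/\ play q sigma h, cluster v0 C F, F `<=` safe h,
      [disjoint safe h & deleted h] &
      forall e, e \in deleted h -> exists2 x : dart G, x.1 = e & source x \in C]
    & #|` safe h| <= p * t /\ #|` deleted h| = q * t.
  elim: t => [|t [h [C [F [ph cl FS SD Dinc]]] [cardS cardD]]].
    exists [::]; last by rewrite /safe /deleted !big_nil !cardfs0 !muln0.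
    exists [fset v0], fset0; rewrite /safe /deleted !big_nil.
    by split=> //; [exact: play_start|exact: cluster_root|exact: fdisjoint0X].
  have [B [C' [F' [ph' cardB DB SD' [cl' F'S Dinc']]]]] :=
    breaker_round ph cl FS SD Dinc.
  exists (rcons h (sigma h, B)); first by exists C', F'.
  have [[cardM _] _] := win ph.
  rewrite safe_rcons deleted_rcons; split.
    by apply: leq_trans (leq_card_fsetU _ _) _; rewrite cardM mulnSr leq_add2r.
  by rewrite cardfsU (eqP DB) cardfs0 cardB cardD mulnSr subn0.
have FD : [disjoint F & deleted h] by apply: fdisjointWl FS SD.
have := card_cluster_boundary regular cl FD Dinc.
have := leq_trans (fsubset_leq_card FS) cardS; rewrite cardD; nia.
Qed.

End Breaker.

(** * Untouched branches, encoded by reduced walks from [v0] under the prefix order *)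

Lemma prefix_comparable (T : eqType) (s t u : seq T) :
  prefix s u -> prefix t u -> prefix s t \/ prefix t s.
Proof.
rewrite !prefixE => /eqP su /eqP tu; have [st|/ltnW ts] := leqP (size s) (size t).
  by left; rewrite -tu take_takel // su.
by right; rewrite -su take_takel // tu.
Qed.

Lemma prefix_rconsE (T : eqType) (s t : seq T) x :
  prefix s (rcons t x) = (s == rcons t x) || prefix s t.
Proof.
apply/idP/idP => [/prefixP[u]|/orP[/eqP ->|/prefix_trans]]; last 2 first.
- exact: prefix_refl.
- by apply; exact: prefix_rcons.
case: (lastP u) => [|{}u y]; first by rewrite cats0 => ->; rewrite eqxx.
by rewrite -rcons_cat => /rcons_inj[-> _]; rewrite prefix_prefix orbT.
Qed.

Section Frontier.
Variables (G : multigraph) (d : nat) (v0 : vertex G).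
Hypotheses (regular : forall v : vertex G, has_degree v d) (acyc : acyclic G).
Implicit Types (x y : dart G) (s t u w : seq (dart G)).
Implicit Types (S D : {fset edge G}) (A : {fset seq (dart G)}).

(** In an acyclic graph such a walk is determined by its endpoint and, if nonempty, by its last
    edge. The branch at [w] consists of the walks extending [w]. *)
Definition rwalk w : bool := walk v0 w (endpoint v0 w) && reduced w.

Lemma rwalk_rcons2 s x y : rwalk (rcons (rcons s x) y) =
  [&& rwalk (rcons s x), source y == target x & y != flip x].
Proof.
rewrite /rwalk reduced_rcons2 walk_rcons /endpoint !map_rcons !last_rcons eqxx.
rewrite andbT 2!walk_rcons eqxx andbT eq_sym.
by case: (walk _ _ _); case: (reduced _); rewrite ?andbF.
Qed.

Lemma rwalk_last_edge s t x y : rwalk (rcons s x) -> rwalk (rcons t y) ->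
  x.1 = y.1 -> rcons s x = rcons t y.
Proof.
rewrite /rwalk /endpoint !map_rcons !last_rcons => /andP[ws rs] /andP[wt rt] xy.
exact: reduced_last_edge acyc xy ws rs wt rt.
Qed.

(* The branch of the tree through the last edge of [w], seen from [v0], that
   edge included, is untouched by both players. *)
Definition fresh S D w : Prop :=
  forall s x, rwalk (rcons s x) -> prefix w (rcons s x) -> x.1 \notin S `|` D.

(** The antichain condition makes the branches pairwise disjoint; safety of all darts of [s] makes
    each branch hang off the safe component of [v0]. *)
Definition frontier S D A : Prop :=
  [/\ [disjoint S & D],
      forall w w', w \in A -> w' \in A -> prefix w w' -> w = w' &
      forall w, w \in A -> exists s x,
        [/\ w = rcons s x, rwalk w, all (fun y => y.1 \in S) s & fresh S D w]].

Lemma frontier_prefix S D A w w' u : frontier S D A ->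
  w \in A -> w' \in A -> prefix w u -> prefix w' u -> w = w'.
Proof.
case=> _ anti _ wA w'A wu w'u.
have [/anti->//|/anti/esym->//] := prefix_comparable wu w'u.
Qed.

Lemma frontier_start : frontier fset0 fset0 [fset [:: x] | x in star v0].
Proof.
split=> [|w w'|w].
- exact: fdisjoint0X.
- move=> /imfsetP[x _ ->] /imfsetP[y _ ->]; rewrite prefixs1 /=.
  by move/eqP.
case/imfsetP=> x /=; rewrite (in_star regular) => /eqP xv ->.
exists [::], x; split=> //; first by rewrite /rwalk /= xv !eqxx.
by move=> s y _ _; rewrite !inE.
Qed.

Lemma card_frontier_start : #|` [fset [:: x] | x in star v0]| = d.
Proof. by rewrite card_imfset ?(card_star regular) // => x y []. Qed.

(** The marked edge is the last one of some [w] in [A]; the [d - 1] reduced one-dart extensions of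
    [w] then replace [w]. *)
Lemma frontier_mark S D A : 1 < d -> frontier S D A -> 0 < #|` A| ->
  exists e A', [/\ e \notin S `|` D, frontier (e |` S) D A' &
    #|` A'| = (#|` A| + (d - 2))%N].
Proof.
move=> d_gt1 fr; rewrite cardfs_gt0 => /fset0Pn[w wA].
have [SD anti frA] := fr; have [s [x [wE rw sS frw]]] := frA w wA.
have xSD : x.1 \notin S `|` D.
  by apply: (frw s x); rewrite -wE //; exact: prefix_refl.
pose K := star (target x) `\ flip x.
have memK y : y \in K -> rwalk (rcons w y).
  rewrite !inE (in_star regular) wE rwalk_rcons2 -wE rw /=.
  by case/andP=> -> ->.
have cardK : #|` K| = d.-1.
  have := cardfsD1 (flip x) (star (target x)).
  by rewrite (card_star regular) (in_star regular) source_flip eqxx -/K => ->.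
pose A' := (A `\ w) `|` [fset rcons w y | y in K].
(* Only [w] itself ends with the newly safe edge, so every branch that does not contain [w] stays
   untouched. *)
have freshI w' : prefix w' w = false -> fresh S D w' -> fresh (x.1 |` S) D w'.
  move=> w'w frw' t y rt w't; rewrite -fsetUA in_fset1U negb_or (frw' t) // andbT.
  apply/eqP => yx; rewrite wE in rw.
  by move: w't; rewrite (rwalk_last_edge rt rw yx) -wE w'w.
have wNrcons y : prefix (rcons w y) w = false.
  by apply/negP => /size_prefix; rewrite size_rcons ltnn.
exists x.1, A'; split=> //.
- split.
  + rewrite fdisjointUX fdisjoint1X SD andbT.
    by apply: contraNN xSD; rewrite inE orbC => ->.
  + move=> w1 w2; rewrite !in_fsetU !in_fsetD1.
    case/orP=> [/andP[w1w w1A]|/imfsetP[y1 /= y1K ->]];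
      case/orP=> [/andP[w2w w2A]|/imfsetP[y2 /= y2K ->]].
    * exact: anti.
    * rewrite prefix_rconsE => /orP[/eqP //|/(anti _ _ w1A wA) w1E].
      by rewrite w1E eqxx in w1w.
    * move=> /(prefix_trans (prefix_rcons _ _))/(anti _ _ wA w2A) w2E.
      by rewrite w2E eqxx in w2w.
    * by rewrite prefix_rconsE wNrcons orbF => /eqP.
  + move=> w1; rewrite in_fsetU in_fsetD1.
    case/orP=> [/andP[w1w w1A]|/imfsetP[y /= yK ->]].
      have [s1 [x1 [w1E rw1 s1S frw1]]] := frA w1 w1A.
      exists s1, x1; split=> //.
        by apply: sub_all s1S => z zS; rewrite in_fsetU zS orbT.
      apply: freshI => //; apply/negP => /(anti _ _ w1A wA) w1w'.
      by rewrite w1w' eqxx in w1w.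
    exists w, y; split=> //; first exact: memK.
      rewrite wE all_rcons in_fset1U eqxx /=.
      by apply: sub_all sS => z zS; rewrite in_fsetU zS orbT.
    apply: freshI => // t z rt /(prefix_trans (prefix_rcons _ _)).
    exact: frw.
rewrite /A' cardfsU.
have -> : (A `\ w) `&` [fset rcons w y | y in K] = fset0.
  apply/fsetP => w1; rewrite in_fsetI in_fsetD1 in_fset0.
  apply/andP => -[/andP[w1w w1A] /imfsetP[y _ w1E]].
  by move: (w1w); rewrite (anti w w1) ?eqxx // w1E prefix_rcons.
rewrite cardfs0 subn0 (card_imfset _ (f := rcons w)) /=; last by move=> y z /rcons_inj[].
(* Losing one branch and gaining [d.-1] is a gain of the truncated [d - 2] because [1 < d]. *)
by rewrite cardK (cardfsD1 w A) wA /=; lia.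
Qed.

Lemma frontier_marks S D A n : 1 < d -> frontier S D A -> 0 < #|` A| ->
  exists M A', [/\ #|` M| = n, [disjoint M & S `|` D],
    frontier (S `|` M) D A' & #|` A'| = (#|` A| + n * (d - 2))%N].
Proof.
move=> d_gt1; elim: n S A => [|n IH] S A fr A_gt0.
  by exists fset0, A; rewrite cardfs0 fsetU0 addn0 fdisjoint0X.
have [e [A1 [eSD fr1 cardA1]]] := frontier_mark d_gt1 fr A_gt0.
have [|M [A2 [cardM MSD fr2 cardA2]]] := IH _ _ fr1; first by rewrite cardA1; lia.
move: MSD; rewrite !fdisjointXU fdisjointX1 -andbA => /and3P[eM MS MD].
exists (e |` M), A2; split.
- by rewrite cardfsU1 eM cardM.
- by rewrite fdisjointUX fdisjoint1X eSD fdisjointXU MS.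
- by rewrite fsetUCA fsetUA.
- by rewrite cardA2 cardA1; lia.
Qed.

(** By [rwalk_last_edge] only one reduced walk can end with [e], and by disjointness it lies in at
    most one branch, which is dropped. *)
Lemma frontier_delete S D A e : e \notin S -> frontier S D A ->
  exists2 A', frontier S (e |` D) A' & #|` A| <= #|` A'|.+1.
Proof.
move=> eS fr; have [SD anti frA] := fr.
have SeD : [disjoint S & e |` D] by rewrite fdisjointXU fdisjointX1 eS.
pose hit w := exists s x, [/\ rwalk (rcons s x), prefix w (rcons s x) & x.1 = e].
have freshI w : ~ hit w -> fresh S D w -> fresh S (e |` D) w.
  move=> nhit frw s x rx wx; rewrite fsetUCA in_fset1U negb_or (frw s) // andbT.
  by apply/eqP => xe; apply: nhit; exists s, x.
have [[w [wA [s [x [rx wx xe]]]]]|nohit] := pselect (exists w, w \in A /\ hit w).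
  exists (A `\ w); last by have := cardfsD1 w A; rewrite wA; lia.
  split=> [//|w1 w2|w1]; rewrite !in_fsetD1.
    by move=> /andP[_ w1A] /andP[_ w2A]; exact: anti.
  case/andP=> w1w w1A; have [s1 [x1 [w1E rw1 s1S frw1]]] := frA w1 w1A.
  exists s1, x1; split=> //; apply: freshI => // -[t [y [ry w1y ye]]].
  move: w1y; rewrite (rwalk_last_edge ry rx) ?ye // => w1x.
  by rewrite (frontier_prefix fr w1A wA w1x wx) eqxx in w1w.
exists A => //; split=> // w wA; have [s [x [wE rw sS frw]]] := frA w wA.
by exists s, x; split=> //; apply: freshI => // hw; apply: nohit; exists w.
Qed.

Lemma frontier_deletes S D A B : [disjoint S & B] -> frontier S D A ->
  exists2 A', frontier S (D `|` B) A' & #|` A| <= #|` A'| + #|` B|.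
Proof.
move=> + fr; elim/finSet_rect: B => B IH SB.
have [->|/fset0Pn[e eB]] := eqVneq B fset0.
  by exists A; rewrite ?fsetU0 // cardfs0 addn0.
have eS : e \notin S.
  by apply/negP => eS; move/fdisjointP: SB => /(_ e eS); rewrite eB.
have [||A1 fr1 le1] := IH (B `\ e).
- exact: fproperD1.
- by apply: fdisjointWr SB; exact: fsubsetDl.
have [A2 fr2 le2] := frontier_delete eS fr1.
exists A2; first by rewrite -(fsetD1K eB) fsetUCA.
by have := cardfsD1 e B; rewrite eB; lia.
Qed.

(** One branch suffices: its root is joined to [v0] by safe edges, and inside it a reduced walk can
    be prolonged forever. *)
Lemma frontier_infinite S D A : 1 < d -> frontier S D A -> 0 < #|` A| ->
  infinite_set (component D v0).
Proof.
move=> d_gt1 [SD anti frA]; rewrite cardfs_gt0 => /fset0Pn[w wA].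
have [s [x [wE rw sS frw]]] := frA w wA.
have grow n : exists t y, [/\ rwalk (rcons t y), prefix w (rcons t y),
    all (fun z => z.1 \notin D) (rcons t y) & size t = (size s + n)%N].
  elim: n => [|n [t [y [rt wt tD szt]]]].
    exists s, x; rewrite -wE addn0 prefix_refl; split=> //.
    rewrite wE all_rcons; have := frw s x; rewrite -wE => /(_ rw (prefix_refl _)).
    rewrite in_fsetU negb_or => /andP[_ ->] /=.
    by apply: sub_all sS => z zS; move/fdisjointP: SD; apply.
  have /fset0Pn[z] : star (target y) `\ flip y != fset0.
    rewrite -cardfs_gt0; have := cardfsD1 (flip y) (star (target y)).
    rewrite (card_star regular) (in_star regular) source_flip eqxx; lia.
  rewrite !inE (in_star regular) => /andP[zy yz].
  have rz : rwalk (rcons (rcons t y) z) by rewrite rwalk_rcons2 rt yz zy.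
  have wz := prefix_trans wt (prefix_rcons (rcons t y) z).
  exists (rcons t y), z; split=> //; last by rewrite size_rcons szt addnS.
  rewrite all_rcons tD andbT.
  by have := frw _ _ rz wz; rewrite in_fsetU negb_or => /andP[].
have {}grow n : exists t, [/\ rwalk t, all (fun z => z.1 \notin D) t &
    size t = (size s + n).+1%N].
  by have [t [y [? _ ? szt]]] := grow n; exists (rcons t y); rewrite size_rcons szt.
have [f fP] := choice grow.
apply/infiniteP.
apply: (@card_le_trans _ _ _ ((fun n => endpoint v0 (f n)) @` setT)%classic).
  (* The walks [f n] have distinct lengths, so by uniqueness of reduced walks their endpoints
     differ. *)
  have inj : {in [set: nat]%classic &, injective (fun n => endpoint v0 (f n))}.
    move=> m n _ _ mn; have [/andP[wm rm] _ szm] := fP m.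
    have [/andP[wn rn] _ szn] := fP n; rewrite mn in wm.
    have fmn := reduced_unique acyc wm rm wn rn.
    by move: szm; rewrite fmn szn => -[] /addnI.
  by have /card_eqPle[_ ->] := inj_card_eq inj.
apply: subset_card_le => _ [n _ <-]; have [/andP[wn _] nD _] := fP n.
by exists (f n).
Qed.

End Frontier.

(** * Maker's strategy from the invariant on branches *)

Section Maker.
Variables (G : multigraph) (d p q : nat) (v0 : vertex G).
Hypotheses (regular : forall v : vertex G, has_degree v d) (acyc : acyclic G).
Hypotheses (d_gt1 : 1 < d) (qpd : q <= p * (d - 2)).

Definition good_for_maker (S D : {fset edge G}) : Prop :=
  exists2 A, frontier v0 S D A & d <= #|` A|.

(** The implication stands under the existential so that choice yields a strategy on all histories,
    including those where the invariant fails. *)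
Lemma good_maker_move (h : history G) : exists M,
  good_for_maker (safe h) (deleted h) ->
  maker_legal p h M /\ forall B, breaker_legal q h M B ->
    good_for_maker (safe (rcons h (M, B))) (deleted (rcons h (M, B))).
Proof.
have [[A fr dA]|] := pselect (good_for_maker (safe h) (deleted h)); last first.
  by exists fset0.
have [|M [A1 [cardM MSD fr1 cardA1]]] := frontier_marks regular acyc p d_gt1 fr.
  by apply: leq_trans dA; exact: ltnW.
exists M => _; split=> [|B [cardB legB]].
  split=> // e eM; move/fdisjointP: MSD => /(_ e eM).
  by rewrite in_fsetU negb_or => /andP.
have SB : [disjoint safe h `|` M & B].
  rewrite fdisjoint_sym; apply/fdisjointP => e /legB[eS eM _].
  by rewrite in_fsetU negb_or eS.
have [A2 fr2 le2] := frontier_deletes acyc SB fr1.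
(* The gain [p * (d - 2)] covers the loss of at most [q] branches. *)
rewrite safe_rcons deleted_rcons; exists A2 => //; lia.
Qed.

Lemma maker_wins : maker_has_winning_strategy p q v0.
Proof.
have [sigma sigmaP] := choice good_maker_move; exists sigma => h ph.
have good : good_for_maker (safe h) (deleted h).
  elim: ph => [|{}h B _ IH legB]; last by have [_] := sigmaP h IH; apply.
  rewrite /safe /deleted !big_nil; exists [fset [:: x] | x in star v0].
    exact: frontier_start.
  by rewrite (card_frontier_start v0 regular).
have [legM _] := sigmaP h good; split=> //; have [A fr dA] := good.
apply: frontier_infinite fr _ => //; apply: leq_trans dA; exact: ltnW.
Qed.

End Maker.

Theorem theorem1p5 (p q d : nat) (hp : 0 < p) (hq : 0 < q) (hd : 2 <= d)
    (T : multigraph) (hT : infinite_regular_tree T d) (v0 : vertex T) :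
  maker_has_winning_strategy p q v0 <-> q <= p * (d - 2).
Proof.
have [infV conn acyc reg] := hT; split=> [[sigma win]|qpd].
  have infE := infinite_edges v0 infV conn.
  rewrite leqNgt; apply/negP => pq.
  (* If [q] exceeds [p * (d - 2)] by at least 1, the bound forces [t <= d]; so [t = d.+1] is
     contradictory. *)
  have := breaker_bound reg infE win d.+1; nia.
exact: maker_wins reg acyc hd qpd.
Qed.
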